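(* For every measure space $(M,\Sigma,\mu)$, the real Banach space $L_\infty(\mu)$ admits a lattice tiling by balls.
   Context: A lattice tiling of a real normed space $X$ by balls is a family $\{B_X+\lambda\}_{\lambda\in\Lambda}$, where $B_X$ is the closed unit ball of $X$ and $\Lambda$ is a discrete additive subgroup of $X$, whose members have pairwise disjoint interiors and cover $X$. *)

(* Defs.v *)
From HB Require Import structures.
From mathcomp Require Import all_boot all_order all_algebra.
From mathcomp Require Import all_classical all_reals all_analysis.
From mathcomp Require Import measurable_realfun ess_sup_inf.

Set Implicit Arguments.
Unset Strict Implicit.
Unset Printing Implicit Defensive.
Import Order.TTheory GRing.Theory Num.Theory.
Import numFieldNormedType.Exports.
Local Open Scope classical_set_scope.
Local Open Scope ring_scope.

Section LatticeTiling.
Context (R : realType) (X : normedModType R).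

Definition unit_ball : set X := [set x | `|x| <= 1].

Definition ball_translate (l : X) : set X := [set b + l | b in unit_ball].

Definition discrete_subgroup (L : set X) : Prop :=
  [/\ L 0, (forall x y, L x -> L y -> L (x - y))
    & forall x, L x -> isolated L x].

Definition lattice_tiling (L : set X) : Prop :=
  [/\ discrete_subgroup L,
      trivIset L (fun l => (ball_translate l)^°)
    & \bigcup_(l in L) ball_translate l = [set: X]].

End LatticeTiling.

Definition admits_lattice_tiling (R : realType) (X : normedModType R) : Prop :=
  exists L : set X, lattice_tiling L.

Lemma ae_eq_Lnorm d (T : measurableType d) (R : realType)
    (mu : {measure set T -> \bar R}) (p : \bar R) (f g : T -> R) :
  (1 <= p)%E -> measurable_fun setT f -> measurable_fun setT g ->
  (f = g %[ae mu]) -> ('N[mu]_p[EFin \o f] = 'N[mu]_p[EFin \o g])%E.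
Proof.
move=> p1 mf mg fg; rewrite unlock /Lnorm; case: p p1 => // [r _|_].
- have mX (h : T -> R) : measurable_fun setT h ->
      measurable_fun setT (fun x => `|(EFin \o h) x| `^ r)%E.
    move=> mh; apply: (measurableT_comp (measurable_poweR _)).
    by apply: measurableT_comp => //; exact/measurable_EFinP.
  congr (_ `^ _)%E; apply: ae_eq_integral => //; [exact: mX|exact: mX|].
  by apply: filterS fg => x fgx _ /=; rewrite fgx.
- case: ifPn => // _; apply: eq_ess_sup.
  by apply: filterS fg => x /(_ I) /= ->.
Qed.

(* The library's [LspaceType mu p1] is the bare type of a.e.-classes of
   measurable functions with finite Lp norm.  Its vector space structure and
   norm are transported from [LfunType mu p1] (functions rather than classes)
   along the class map [Lclass] and the choice of representatives [Lrepr]. *)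
Section LspaceNormed.
Context d (T : measurableType d) (R : realType).
Variables (mu : {measure set T -> \bar R}) (p : \bar R) (p1 : (1 <= p)%E).

Local Notation Lf := (LfunType mu p1).
Local Notation Ls := (LspaceType mu p1).
(* [measurableTypeR R] and [R] carry the same sigma-algebra under different
   displays; [LspaceType] uses the former and [LfunType] the latter. *)
Local Notation Mf := {mfun T >-> measurableTypeR R}.
Local Notation Mq := {mfun_ mu, T >-> measurableTypeR R}.

Definition Mf_of (f : Lf) : Mf :=
  HB.pack (f : T -> measurableTypeR R)
    (isMeasurableFun.Build _ _ T (measurableTypeR R) f
      (@measurable_funPT _ _ _ _ f)).
Definition Mclass (f : Lf) : Mq := (\pi_Mq (Mf_of f))%qT.

Lemma MclassK (f : Lf) : (Mclass f : T -> R) = f %[ae mu].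
Proof. by apply/asboolP/(@eqquotP _ (ae_eq_op mu) Mq _ (Mf_of f)); rewrite reprK. Qed.

Lemma Mclass_finite (f : Lf) : finite_norm mu p (Mclass f).
Proof.
rewrite /finite_norm (ae_eq_Lnorm p1 _ _ (MclassK f)) //.
  exact: Lfunction_finite.
exact: (@measurable_funPT _ _ _ _ (repr (Mclass f))).
Qed.

Definition Lclass (f : Lf) : Ls :=
  HB.pack (Mclass f) (isFinLebesgue.Build _ _ _ mu p p1 _ (Mclass_finite f)).

Lemma Ls_inj (f g : Ls) : f = g :> Mq -> f = g.
Proof.
case: f g => [f [[fP]]] [g [[gP]]] /= fg; subst g.
by rewrite (Prop_irrelevance fP gP).
Qed.

Lemma Lspace_Lfun (f : Ls) : (f : T -> R) \in Lfun mu p.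
Proof.
apply/andP; split; apply/mem_set.
  exact: (@measurable_funPT _ _ _ _ (repr (f : Mq))).
exact: Lebesgue_finite.
Qed.

Definition Lrepr (f : Ls) : Lf := Lfun_Sub p1 (Lspace_Lfun f).

Lemma LreprE (f : Ls) : Lrepr f = f :> (T -> R).
Proof. by []. Qed.

Lemma LclassK (f : Lf) : (Lrepr (Lclass f) : T -> R) = f %[ae mu].
Proof. exact: MclassK. Qed.

Lemma eq_Lclass (f g : Lf) : ((f : T -> R) = g %[ae mu]) -> Lclass f = Lclass g.
Proof. by move=> fg; apply/Ls_inj/(@eqquotP _ (ae_eq_op mu) Mq)/asboolP. Qed.

Lemma LreprK : cancel Lrepr Lclass.
Proof.
move=> f; apply: Ls_inj => /=; rewrite -[RHS]reprK.
by apply/(@eqquotP _ (ae_eq_op mu) Mq)/asboolP/aeW.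
Qed.

HB.instance Definition _ := gen_eqMixin Ls.
HB.instance Definition _ := gen_choiceMixin Ls.

Definition Ladd (f g : Ls) : Ls := Lclass (Lrepr f + Lrepr g).
Definition Lopp (f : Ls) : Ls := Lclass (- Lrepr f).
Definition Lscale (a : R) (f : Ls) : Ls := Lclass (a *: Lrepr f).

Lemma LfunDE (f g : Lf) x : (f + g) x = f x + g x. Proof. by []. Qed.

Lemma LfunNE (f : Lf) x : (- f) x = - f x. Proof. by []. Qed.

Lemma LfunZE a (f : Lf) x : (a *: f) x = a * f x. Proof. by []. Qed.

Lemma LclassD (f g : Lf) : Lclass (f + g) = Ladd (Lclass f) (Lclass g).
Proof.
apply/esym/eq_Lclass; apply: filterS2 (LclassK f) (LclassK g) => x fx gx _.
by rewrite !LfunDE fx // gx.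
Qed.

Lemma LclassN (f : Lf) : Lclass (- f) = Lopp (Lclass f).
Proof.
apply/esym/eq_Lclass; apply: filterS (LclassK f) => x fx _.
by rewrite !LfunNE fx.
Qed.

Lemma LclassZ (a : R) (f : Lf) : Lclass (a *: f) = Lscale a (Lclass f).
Proof.
apply/esym/eq_Lclass; apply: filterS (LclassK f) => x fx _.
by rewrite !LfunZE fx.
Qed.

Lemma LaddA : associative Ladd.
Proof.
move=> f g h; rewrite -(LreprK f) -(LreprK g) -(LreprK h).
by rewrite -!LclassD addrA.
Qed.

Lemma LaddC : commutative Ladd.
Proof. by move=> f g; rewrite /Ladd addrC. Qed.

Lemma Ladd0 : left_id (Lclass 0) Ladd.
Proof. by move=> f; rewrite -{1}(LreprK f) -LclassD add0r LreprK. Qed.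

Lemma LaddN : left_inverse (Lclass 0) Lopp Ladd.
Proof.
by move=> f; rewrite -{2}(LreprK f) -LclassD addNr.
Qed.

HB.instance Definition _ := GRing.isZmodule.Build Ls LaddA LaddC Ladd0 LaddN.

Lemma LscaleA a b (f : Ls) : Lscale a (Lscale b f) = Lscale (a * b) f.
Proof. by rewrite -LclassZ scalerA. Qed.

Lemma Lscale1 : left_id 1 Lscale.
Proof. by move=> f; rewrite /Lscale scale1r LreprK. Qed.

Lemma LscaleDr : right_distributive Lscale +%R.
Proof.
have LD (u v : Lf) : Lclass u + Lclass v = Lclass (u + v) by rewrite LclassD.
move=> a f g; rewrite -(LreprK f) -(LreprK g).
by rewrite LD -!LclassZ LD scalerDr.
Qed.

Lemma LscaleDl (f : Ls) : {morph Lscale^~ f : a b / a + b}.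
Proof. by move=> a b; rewrite /Lscale scalerDl LclassD. Qed.

HB.instance Definition _ :=
  GRing.Zmodule_isLmodule.Build R Ls LscaleA Lscale1 LscaleDr LscaleDl.

Definition Lspace_norm (f : Ls) : R := fine ('N[mu]_p[EFin \o f])%E.

Lemma Lspace_norm_class (f : Lf) :
  Lspace_norm (Lclass f) = fine ('N[mu]_p[EFin \o f])%E.
Proof. by congr fine; apply: (ae_eq_Lnorm p1 _ _ (LclassK f)). Qed.

Lemma ler_Lspace_normD (f g : Ls) :
  Lspace_norm (f + g) <= Lspace_norm f + Lspace_norm g.
Proof. by rewrite Lspace_norm_class; exact: ler_LnormD. Qed.

Lemma Lspace_normZ (a : R) (f : Ls) :
  Lspace_norm (a *: f) = `|a| * Lspace_norm f.
Proof.
rewrite Lspace_norm_class; apply: EFin_inj.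
by rewrite finite_norm_fine EFinM (finite_norm_fine (Lrepr f)) -LnormZ.
Qed.

Lemma Lspace_norm0_eq0 (f : Ls) : Lspace_norm f = 0 -> f = 0.
Proof.
move=> /(@fine_Lnormr_eq0 _ _ _ _ _ p1 (Lrepr f)) f0.
by rewrite -(LreprK f); exact: eq_Lclass.
Qed.

HB.instance Definition _ := Lmodule_isNormed.Build R Ls
  ler_Lspace_normD Lspace_normZ Lspace_norm0_eq0.

Lemma Lspace_normE (f : Ls) : `|f| = fine ('N[mu]_p[EFin \o f])%E.
Proof. by []. Qed.

End LspaceNormed.

Definition Linfty d (M : measurableType d) (R : realType)
    (mu : {measure set M -> \bar R}) : normedModType R :=
  LspaceType mu (leey 1%E).

(* Main.v *)
Require Import Defs.
From mathcomp Require Import all_boot all_order all_algebra.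
From mathcomp Require Import all_classical all_reals all_analysis.
From mathcomp Require Import measurable_realfun ess_sup_inf lra.
Local Open Scope classical_set_scope.
Local Open Scope ring_scope.
Import Order.TTheory GRing.Theory Num.Theory.
Import numFieldNormedType.Exports.

(** The lattice consists of the classes of functions with values in the even
    integers almost everywhere.  The closed interval [-1, 1] tiles the real
    line by its translates under the even integers, and the supremum norm
    makes this work in all coordinates at once.  The balls cover the space
    because rounding every value of a function [f] to a nearest even integer
    moves it by at most 1; the rounding is monotone, so it preserves
    measurability, and the rounded function is essentially bounded because [f]
    is ([even_valued_dense]).  The interiors are disjoint because a nonzero
    even integer has absolute value at least 2, so a nonzero element of the
    lattice has norm at least 2 ([even_valued_separated]).

    A subgroup with these two properties gives a lattice tiling in any normed
    space ([separated_dense_lattice_tiling]).  Both reduce to facts about real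
    numbers because a norm bound is a bound almost everywhere
    ([Linfty_norm_leP]). *)

Section SeparatedSubgroup.
Context (R : realType) (X : normedModType R).

(** Closed balls of positive radius in a normed space have the open balls as
    interiors, so two tiles whose interiors meet have centres at distance
    less than 2. *)
Lemma interior_ball_translate (l x : X) :
  (ball_translate l)° x -> `|l - x| < 1.
Proof.
have -> : ball_translate l = closed_ball l 1.
  rewrite closed_ballE//; apply/seteqP; split => y /=.
    by move=> [b b1 <-]; rewrite /closed_ball_/= opprD addrCA subrr addr0 normrN.
  move=> yl; exists (y - l); last by rewrite subrK.
  by rewrite /unit_ball/= distrC.
by rewrite interior_closed_ballE// -ball_normE.
Qed.

Lemma separated_dense_lattice_tiling (L : set X) :
  L 0 -> (forall x y, L x -> L y -> L (x - y)) ->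
  (forall x, L x -> `|x| < 2 -> x = 0) ->
  (forall x, exists2 l, L l & `|x - l| <= 1) ->
  lattice_tiling L.
Proof.
move=> L0 LB Lsep Ldense.
have Leq x y : L x -> L y -> `|x - y| < 2 -> x = y.
  by move=> Lx Ly xy; apply/eqP; rewrite -subr_eq0; apply/eqP/Lsep => //; exact: LB.
split.
- split => // x Lx; split; first exact/mem_set.
  exists (ball x 2); first exact: nbhsx_ballx.
  apply/seteqP; split => [y [+ Ly]|y ->]; last by split => //; exact: ballxx.
  by rewrite -ball_normE => /= xy; apply/esym/Leq.
- move=> x y Lx Ly [z [/interior_ball_translate xz /interior_ball_translate yz]].
  apply: Leq => //; apply: le_lt_trans (ler_distD z _ _) _.
  by rewrite -[2]/(1 + 1) ltrD// distrC.
- apply/seteqP; split => // x _; have [l Ll xl] := Ldense x.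
  by exists l => //; exists (x - l) => //; rewrite subrK.
Qed.

End SeparatedSubgroup.

Section RoundEven.
Context (R : realType).

Definition round_even (t : R) : R := 2 * (Num.floor ((t + 1) / 2))%:~R.

Lemma round_even_half_int (t : R) : round_even t / 2 \is a Num.int.
Proof. by rewrite /round_even mulrAC divff// mul1r intr_int. Qed.

Lemma round_even_dist (t : R) : `|t - round_even t| <= 1.
Proof.
rewrite /round_even; have := floor_le ((t + 1) / 2).
have := floorD1_gt ((t + 1) / 2); rewrite intrD.
set z := _%:~R => h1 h2; rewrite ler_norml; lra.
Qed.

(** Rounding is not continuous, so its measurability comes from monotony. *)
Lemma measurable_round_even : measurable_fun setT round_even.
Proof.
apply: nondecreasing_measurable => // s t st.
rewrite /round_even ler_pM2l// ler_int le_floor// ler_pM2r ?invr_gt0//.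
by rewrite lerD2r.
Qed.

Lemma even_lt2_eq0 (t : R) : t / 2 \is a Num.int -> `|t| < 2 -> t = 0.
Proof.
move=> tint t2; apply/eqP; apply: contraTT t2 => t0; rewrite -leNgt.
have := norm_intr_ge1 tint; rewrite mulf_neq0// ?invr_neq0// => /(_ isT).
by rewrite normrM normfV [`|2|]ger0_norm// ler_pdivlMr// mul1r.
Qed.

End RoundEven.

Section LinftyAe.
Context (R : realType) (d : measure_display) (M : measurableType d).
Context (mu : {measure set M -> \bar R}).

Local Notation Lf := (LfunType mu (leey 1%E)).

Lemma Linfty_subE (f g : Linfty mu) :
  \forall x \ae mu, (f - g : Linfty mu) x = f x - g x.
Proof.
have -> : f - g = Lclass (Lrepr f - Lrepr g).
  by rewrite LclassD LclassN !LreprK.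
by apply: filterS (LclassK (Lrepr f - Lrepr g)) => x /(_ I).
Qed.

Lemma Linfty0E : \forall x \ae mu, (0 : Linfty mu) x = 0.
Proof. by apply: filterS (LclassK (0 : Lf)) => x /(_ I). Qed.

Lemma Linfty_eq0 (f : Linfty mu) : (\forall x \ae mu, f x = 0) -> f = 0.
Proof.
move=> f0; rewrite -(LreprK f); apply: eq_Lclass.
by apply: filterS f0 => x fx _.
Qed.

(** The norm is the essential supremum except over a space of measure zero,
    where it is 0; there all almost everywhere bounds hold, and [0 <= c] makes
    both sides true. *)
Lemma Lnormy_leP (f : M -> R) (c : R) : 0 <= c ->
  ('N[mu]_+oo[EFin \o f] <= c%:E)%E <-> \forall x \ae mu, `|f x| <= c.
Proof.
move=> c0; rewrite unlock /Lnorm; case: ifPn => mu0.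
  split=> [/ess_supP|fc]; first by apply: filterS => x; rewrite /= lee_fin.
  by apply/ess_supP; apply: filterS fc => x; rewrite /= lee_fin.
rewrite lee_fin c0; split=> // _; exists setT; split => //.
by apply/eqP; rewrite eq_le measure_ge0 andbT leNgt.
Qed.

Lemma Linfty_norm_leP (f : Linfty mu) (c : R) : 0 <= c ->
  `|f| <= c <-> \forall x \ae mu, `|f x| <= c.
Proof.
move=> c0; rewrite -Lnormy_leP// Lspace_normE -lee_fin.
by rewrite (finite_norm_fine (Lrepr f)).
Qed.

Lemma Linfty_of_ae_bounded (g : M -> R) (c : R) : 0 <= c ->
  measurable_fun setT g -> (\forall x \ae mu, `|g x| <= c) ->
  exists h : Linfty mu, \forall x \ae mu, h x = g x.
Proof.
move=> c0 mg gc.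
have gL : g \in Lfun mu +oo%E.
  apply/andP; split; apply/mem_set => //=.
  by apply: (@le_lt_trans _ _ c%:E); [exact/Lnormy_leP|rewrite ltry].
exists (Lclass (Lfun_Sub (leey 1%E) gL)).
by apply: filterS (LclassK (Lfun_Sub (leey 1%E) gL)) => x /(_ I).
Qed.

Definition even_valued : set (Linfty mu) :=
  [set f | \forall x \ae mu, f x / 2 \is a Num.int].

Lemma even_valued0 : even_valued 0.
Proof. by apply: filterS Linfty0E => x ->; rewrite mul0r. Qed.

Lemma even_valuedB (f g : Linfty mu) :
  even_valued f -> even_valued g -> even_valued (f - g).
Proof.
move=> fE gE; apply: filterS3 (Linfty_subE f g) fE gE => x -> fx gx.
by rewrite mulrBl rpredB.
Qed.

Lemma even_valued_separated (f : Linfty mu) :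
  even_valued f -> `|f| < 2 -> f = 0.
Proof.
move=> fE f2; apply: Linfty_eq0.
have /Linfty_norm_leP : `|f| <= `|f| by [].
move=> /(_ (normr_ge0 _)) fle; apply: filterS2 fE fle => x fx fle.
by apply: even_lt2_eq0 => //; exact: le_lt_trans f2.
Qed.

Lemma even_valued_dense (f : Linfty mu) :
  exists2 l, even_valued l & `|f - l| <= 1.
Proof.
have mf : measurable_fun setT (f : M -> R).
  exact: (@measurable_funPT _ _ _ _ (Lrepr f)).
have [|||l lE] := @Linfty_of_ae_bounded (round_even R \o f) (`|f| + 1).
- by rewrite addr_ge0.
- by apply: measurableT_comp => //; exact: measurable_round_even.
- have /Linfty_norm_leP : `|f| <= `|f| by [].
  move=> /(_ (normr_ge0 _)); apply: filterS => x fx /=.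
  rewrite -[round_even R _](subKr (f x)).
  by apply: le_trans (ler_normB _ _) _; rewrite lerD// round_even_dist.
- exists l; first by apply: filterS lE => x ->; exact: round_even_half_int.
  apply/Linfty_norm_leP => //; apply: filterS2 (Linfty_subE f l) lE => x -> ->.
  exact: round_even_dist.
Qed.

End LinftyAe.

Theorem proposition6p14 (R : realType) (d : measure_display)
    (M : measurableType d) (mu : {measure set M -> \bar R}) :
  admits_lattice_tiling (Linfty mu).
Proof.
exists (@even_valued R d M mu); apply: separated_dense_lattice_tiling.
- exact: even_valued0.
- exact: even_valuedB.
- exact: even_valued_separated.
- exact: even_valued_dense.
Qed.
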